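(* Let $V\subseteq\mathbb{R}_{\le d}[t]^{n\times n}$ be a linear perturbation structure, i.e. the real linear span of a finite set of matrix polynomials of the form $t^lC$ with $0\le l\le d$ and $C\in\mathbb{R}^{n\times n}$, and let $\mathcal{A}\in V$. Suppose that $\mathcal{A}$ has a trivial Smith form and does not have an unattainable non-trivial Smith form under perturbations from $V$. Let $\mathbf{d}'$ be the vector of the largest possible degrees of the entries of $\mathrm{Adj}(\mathcal{A}+\Delta\mathcal{A})$ as $\Delta\mathcal{A}$ ranges over $V$, and let $e=\mathrm{rank}(\mathrm{Syl}_{\mathbf{d}'}(\mathrm{Adj}(\mathcal{A})))$. Then the optimization problem $$\inf_{\Delta\mathcal{A}\in V}\ \|\Delta\mathcal{A}\|_F\quad\text{subject to}\quad \mathrm{rank}\bigl(\mathrm{Syl}_{\mathbf{d}'}(\mathrm{Adj}(\mathcal{A}+\Delta\mathcal{A}))\bigr)<e$$ has an attainable global minimum.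
   Context: $\mathbb{R}_{\le d}[t]^{n\times n}$ is the space of $n\times n$ matrices of real polynomials of degree at most $d$; $\|\cdot\|_F$ is the Euclidean norm of all coefficients of all entries. $\mathrm{Adj}$ is the adjugate (transpose of the cofactor matrix). ''Attainable global minimum'' means that the infimum is achieved by a feasible $\Delta\mathcal{A}$. McCoy rank of $\mathcal{A}$: $\min_{\omega\in\mathbb{C}}\mathrm{rank}\,\mathcal{A}(\omega)$. $\mathcal{A}$ has a non-trivial Smith form if its McCoy rank is at most $n-2$, and a trivial one otherwise. $\mathcal{A}$ has an unattainable non-trivial Smith form (under perturbations from $V$) if the gcd of all entries of $\mathrm{Adj}(\mathcal{A})$ is $1$, but there are arbitrarily small $\Delta\mathcal{A}\in V$ such that the gcd of all entries of $\mathrm{Adj}(\mathcal{A}+\Delta\mathcal{A})$ is not $1$. Convolution matrix: for a polynomial $a=\sum_{j=0}^{D}a_jt^j$ regarded as having degree at most $D$, $\phi_{m}(a)\in\mathbb{R}^{(D+m+1)\times(m+1)}$ is the Toeplitz matrix whose $j$-th column ($j=0,\dots,m$) is $(0,\dots,0,a_0,\dots,a_D,0,\dots,0)^T$ with $j$ leading zeros. Generalized Sylvester matrix: for a vector $\mathbf{f}=(f_1,\dots,f_k)$ of polynomials and a vector $\mathbf{d}'$ of degree bounds with $\deg f_i\le d'_i$, let $\delta$ be the largest entry of $\mathbf{d}'$, attained at a fixed index $p$, and $\ell$ the largest of the remaining entries. Regard $f_p$ as having degree at most $\delta$ and every other $f_i$ as having degree at most $\ell$ (padding with zero coefficients). Then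 $\mathrm{Syl}_{\mathbf{d}'}(\mathbf{f})\in\mathbb{R}^{(\ell+(k-1)\delta)\times(\ell+\delta)}$ is obtained by stacking $\phi_{\ell-1}(f_p)^T$ on top of the matrices $\phi_{\delta-1}(f_i)^T$, $i\ne p$. $\mathrm{Syl}_{\mathbf{d}'}(\mathrm{Adj}(\cdot))$ means this matrix for the vector of all $n^2$ entries of the adjugate.
   Formalization: Added assumption: if ℓ = 0 (second largest degree bound of the adjugate entries; includes n = 1, where ℓ is undefined), then e > 0. Otherwise the claim fails: for constant V and A = I, n = 2, Syl is empty, e = 0 and the constraint is infeasible. *)

(* Defs.v *)
From mathcomp Require Import all_boot all_order all_algebra.
From mathcomp Require Import complex.
From mathcomp Require Import boolp classical_sets reals.

Set Implicit Arguments.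
Unset Strict Implicit.
Unset Printing Implicit Defensive.

Import Order.TTheory GRing.Theory Num.Theory.

Local Open Scope classical_set_scope.
Local Open Scope ring_scope.

Section MatrixPolynomials.
Variables (R : realType) (n : nat).
Implicit Types (M A W D : 'M[{poly R}]_n) (V : set 'M[{poly R}]_n).

Definition frobenius M : R :=
  Num.sqrt (\sum_i \sum_j \sum_(k < size (M i j)) (M i j)`_k ^+ 2).

(* t^l C *)
Definition monomial_mx (l : nat) (C : 'M[R]_n) : 'M[{poly R}]_n :=
  'X^l *: map_mx polyC C.

(* The library's scalars on 'M[{poly R}]_n are polynomials; the span taken here
   is the one with real coefficients. *)
Definition real_span (m : nat) (G : 'I_m -> 'M[{poly R}]_n) :
    set 'M[{poly R}]_n :=
  [set W | exists c : 'I_m -> R, W = \sum_(i < m) (c i)%:P *: G i].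

Definition linear_perturbation_structure (d : nat) V : Prop :=
  exists (m : nat) (l : 'I_m -> nat) (C : 'I_m -> 'M[R]_n),
    (forall i, (l i <= d)%N) /\
    V = real_span (fun i => monomial_mx (l i) (C i)).

Definition eval_mx (w : R[i]) M : 'M[R[i]]_n :=
  map_mx (fun q : {poly R} => (map_poly (real_complex R) q).[w]) M.

Fact mccoy_rank_subproof M :
  exists r, `[< exists w : R[i], \rank (eval_mx w M) = r >].
Proof. by exists (\rank (eval_mx 0 M)); apply/asboolP; exists 0. Qed.

(* The least r which is the rank of M(w) for some complex w. *)
Definition mccoy_rank M : nat := ex_minn (mccoy_rank_subproof M).

(* mccoy_rank M <= n - 2, with an untruncated subtraction. *)
Definition nontrivial_smith M : Prop := (mccoy_rank M + 2 <= n)%N.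

Definition adj_entries M : 'I_(n * n) -> {poly R} :=
  fun i => mxvec (\adj M) 0 i.

(* gcdp is not normalized: "the gcd is 1" is [adj_gcd M %= 1]. *)
Definition adj_gcd M : {poly R} := \big[@gcdp R/0]_(i < n * n) adj_entries M i.

Definition unattainable_nontrivial_smith V A : Prop :=
  adj_gcd A %= 1 /\
  forall eps : R, 0 < eps ->
    exists D, [/\ V D, frobenius D < eps & ~~ (adj_gcd (A + D) %= 1)].

(* The zero polynomial is given degree 0 here. *)
Definition max_adj_degrees V A (d' : 'I_(n * n) -> nat) : Prop :=
  forall i,
    (exists2 D, V D & (size (adj_entries (A + D) i)).-1 = d' i) /\
    (forall D, V D -> ((size (adj_entries (A + D) i)).-1 <= d' i)%N).

End MatrixPolynomials.

(* phi_(c-1)(a), when a is regarded as having degree at most r - c. *)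
Definition conv_mx (R : realType) (r c : nat) (a : {poly R}) : 'M[R]_(r, c) :=
  \matrix_(i < r, j < c) (if (j <= i)%N then a`_(i - j) else 0).

Definition second_degree (k : nat) (d' : 'I_k -> nat) (p : 'I_k) : nat :=
  \max_(i < k | i != p) d' i.

(* The index p is meant to be one at which d' is largest.  The family
   [lift p i], i < k.-1, enumerates the indices other than p.
   If second_degree d' p = 0, the block of f p has no rows: the matrix can then
   be zero (or 0 x 0, if also d' p = 0) although f p <> 0, and the constraint
   "rank below that of the unperturbed matrix" is infeasible.  This happens for
     A = diag(1,1,0),  V = { [[x, z t, 0], [y, x, 0], [0, y, 0]] },
   where the gcd of the adjugate entries stays 1 near A.  Hence the assumption
   of a positive rank when second_degree d' p = 0. *)
Definition sylvester (R : realType) (k : nat) (d' : 'I_k -> nat) (p : 'I_k)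
    (f : 'I_k -> {poly R}) :
    'M[R]_(second_degree d' p + \sum_(i < k.-1) d' p,
           second_degree d' p + d' p) :=
  let ell := second_degree d' p in
  let delta := d' p in
  col_mx (conv_mx (ell + delta) ell (f p))^T
         (\mxcol_(i < k.-1) (conv_mx (ell + delta) delta (f (lift p i)))^T).

(* inf is the real infimum as soon as f is bounded below on S, e.g. when f is a
   norm (S is nonempty, as it contains x). *)
Definition infimum_attained (T : Type) (R : realType) (f : T -> R) (S : set T) :
    Prop :=
  exists2 x, S x & f x = inf [set f y | y in S].

(* Main.v *)
Require Import Defs.
From mathcomp Require Import all_boot all_order all_algebra.
From mathcomp Require Import perm complex.
From mathcomp Require Import boolp classical_sets reals.
From mathcomp Require Import topology normedtype derive.

(* In coefficient coordinates the feasible set is a closed subset of R^N on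
   which the Frobenius norm is the Euclidean norm, so a minimizer exists as soon
   as the feasible set is nonempty.  It is closed because
   [rank M >= e] iff [det (P M Q) <> 0] for some [P] and [Q], and the entries of
   the Sylvester matrix are polynomial in the perturbation.  For n >= 2 the
   perturbation - A is feasible: Adj(0) = 0, so the constraint reads e > 0.
   If e = 0 then Adj(A) = 0 (outside the degenerate case), whence A(w) has rank
   at most n - 2 everywhere, and the Smith form of A would be non-trivial. *)

Set Implicit Arguments.
Unset Strict Implicit.
Unset Printing Implicit Defensive.

Import Order.TTheory GRing.Theory Num.Theory numFieldNormedType.Exports.

Local Open Scope classical_set_scope.
Local Open Scope ring_scope.

(** * Continuity of polynomial expressions, determinants and adjugates *)

Section ContinuousSums.
Variables (K : numFieldType) (T : topologicalType).

Lemma continuous_sumr (I : Type) (r : seq I) (P : pred I) (F : I -> T -> K) :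
  (forall i, P i -> continuous (F i)) ->
  continuous (fun x => \sum_(i <- r | P i) F i x).
Proof.
move=> cF; elim: r => [|i r IHr].
  by under eq_fun do [rewrite big_nil]; exact: cst_continuous.
case Pi: (P i); under eq_fun do [rewrite big_cons Pi]; last exact: IHr.
by move=> x; exact: (continuousD (cF i Pi x) (IHr x)).
Qed.

Lemma continuous_prodr (I : Type) (r : seq I) (P : pred I) (F : I -> T -> K) :
  (forall i, P i -> continuous (F i)) ->
  continuous (fun x => \prod_(i <- r | P i) F i x).
Proof.
move=> cF; elim: r => [|i r IHr].
  by under eq_fun do [rewrite big_nil]; exact: cst_continuous.
case Pi: (P i); under eq_fun do [rewrite big_cons Pi]; last exact: IHr.
by move=> x; exact: (continuousM (cF i Pi x) (IHr x)).
Qed.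

Lemma continuous_det (m : nat) (F : T -> 'M[K]_m) :
  (forall i j, continuous (fun x => F x i j)) -> continuous (fun x => \det (F x)).
Proof.
move=> cF; apply: continuous_sumr => s _ x.
have cp : continuous (fun y => \prod_i F y i (s i)) by exact: continuous_prodr.
exact: (continuousM (@cst_continuous _ _ ((-1) ^+ s : K) x) (cp x)).
Qed.

Lemma continuous_mulmx (m q r : nat) (F : T -> 'M[K]_(m, q))
    (G : T -> 'M[K]_(q, r)) i j :
  (forall i j, continuous (fun x => F x i j)) ->
  (forall i j, continuous (fun x => G x i j)) ->
  continuous (fun x => (F x *m G x) i j).
Proof.
move=> cF cG; under eq_fun do [rewrite mxE].
by apply: continuous_sumr => k _ x; exact: (continuousM (cF _ _ x) (cG _ _ x)).
Qed.

(** Continuity is taken coefficient by coefficient, without a topology on polynomials. Sums and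
    products preserve it, as each coefficient of the result involves only finitely many coefficients
    of the arguments. *)
Definition coef_continuous (F : T -> {poly K}) :=
  forall k, continuous (fun x => (F x)`_k).

Lemma coef_continuous_cst (q : {poly K}) : coef_continuous (fun=> q).
Proof. by move=> k; exact: cst_continuous. Qed.

Lemma coef_continuousD F G :
  coef_continuous F -> coef_continuous G -> coef_continuous (fun x => F x + G x).
Proof.
move=> cF cG k; under eq_fun do [rewrite coefD].
by move=> x; apply: (continuousD (cF k x) (cG k x)).
Qed.

Lemma coef_continuousM F G :
  coef_continuous F -> coef_continuous G -> coef_continuous (fun x => F x * G x).
Proof.
move=> cF cG k; under eq_fun do [rewrite coefM].
by apply: continuous_sumr => i _ x; apply: (continuousM (cF i x) (cG _ x)).
Qed.

Lemma coef_continuous_sum (I : Type) (r : seq I) (P : pred I)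
    (F : I -> T -> {poly K}) :
  (forall i, P i -> coef_continuous (F i)) ->
  coef_continuous (fun x => \sum_(i <- r | P i) F i x).
Proof.
move=> cF k; under eq_fun do [rewrite coef_sum].
by apply: continuous_sumr => i Pi; exact: cF.
Qed.

Lemma coef_continuous_prod (I : Type) (r : seq I) (P : pred I)
    (F : I -> T -> {poly K}) :
  (forall i, P i -> coef_continuous (F i)) ->
  coef_continuous (fun x => \prod_(i <- r | P i) F i x).
Proof.
move=> cF; elim: r => [|i r IHr].
  by under eq_fun do [rewrite big_nil]; exact: coef_continuous_cst.
case Pi: (P i); under eq_fun do [rewrite big_cons Pi]; last exact: IHr.
by apply: coef_continuousM => //; exact: cF.
Qed.

Lemma coef_continuous_det (m : nat) (F : T -> 'M[{poly K}]_m) :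
  (forall i j, coef_continuous (fun x => F x i j)) ->
  coef_continuous (fun x => \det (F x)).
Proof.
move=> cF; apply: coef_continuous_sum => s _.
apply: coef_continuousM; first exact: coef_continuous_cst.
exact: coef_continuous_prod.
Qed.

Lemma coef_continuous_adj (m : nat) (F : T -> 'M[{poly K}]_m) i j :
  (forall i j, coef_continuous (fun x => F x i j)) ->
  coef_continuous (fun x => (\adj (F x)) i j).
Proof.
move=> cF; under eq_fun do [rewrite mxE].
apply: coef_continuousM; first exact: coef_continuous_cst.
apply: coef_continuous_det => k l.
by under eq_fun do [rewrite !mxE]; exact: cF.
Qed.

Lemma closed_zero_locus (f : T -> K) :
  continuous f -> closed [set x | f x = 0].
Proof.
move=> cf; apply: (@preimage_closed _ _ f [set 0]).
  by move=> x _; exact: cf.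
by apply: accessible_closed_set1; apply: hausdorff_accessible; exact: norm_hausdorff.
Qed.

End ContinuousSums.

(** * Rank conditions: closedness, and vanishing of the adjugate *)

Lemma mulmx_eq1_of_rank (F : fieldType) (m q r : nat) (M : 'M[F]_(m, q)) :
  (r <= \rank M)%N -> exists P Q, P *m M *m Q = 1%:M :> 'M_r.
Proof.
move=> le_r; have le_rm := leq_trans le_r (rank_leq_row M).
have le_rq := leq_trans le_r (rank_leq_col M).
(* [P] and [Q] undo the invertible factors around [pid_mx (\rank M)] in the Gaussian decomposition
   of [M], then keep the leading block of size [r]. *)
exists (pid_mx r *m invmx (col_ebase M)), (invmx (row_ebase M) *m pid_mx r).
rewrite -{2}(mulmx_ebase M) !mulmxA mulmxKV ?col_ebase_unit //.
rewrite mulmxK ?row_ebase_unit // -!mulmxA.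
rewrite mul_pid_mx mul_pid_mx (minn_idPr le_r) (minn_idPr le_rq) minnn.
by rewrite (minn_idPr le_rm) pid_mx_1.
Qed.

(** Constant matrices [P] and [Q] take the place of selections of rows and columns, so minors need
    no indexing; the intersection is infinite in general, which closedness allows. *)
Lemma rank_lt_closed (K : numFieldType) (T : topologicalType) (m q r : nat)
    (F : T -> 'M[K]_(m, q)) :
  (forall i j, continuous (fun x => F x i j)) ->
  closed [set x | (\rank (F x) < r)%N].
Proof.
move=> cF.
have -> : [set x | (\rank (F x) < r)%N] =
    \bigcap_(PQ in [set: 'M[K]_(r, m) * 'M[K]_(q, r)])
      [set x | \det (PQ.1 *m F x *m PQ.2) = 0].
  apply/seteqP; split=> x /=.
    move=> rx [P Q] _ /=; apply/eqP; apply: contraTT rx.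
    rewrite -unitfE -/(_ \in unitmx) => u; rewrite -leqNgt.
    rewrite -(mxrank_unit u); apply: leq_trans (mxrankM_maxl _ _) _.
    exact: mxrankM_maxr.
  move=> h; rewrite ltnNge; apply/negP => /mulmx_eq1_of_rank [P [Q PQ1]].
  by have := h (P, Q) I; rewrite /= PQ1 det1 => /eqP; rewrite oner_eq0.
apply: closed_bigI => -[P Q] _ /=; apply: closed_zero_locus.
apply: continuous_det => i j; apply: continuous_mulmx => k l; last first.
  exact: cst_continuous.
by apply: continuous_mulmx => // ? ?; exact: cst_continuous.
Qed.

(** [maxrankfun] selects rows forming a basis of the row space. There are at most [m] of them, so
    some row is not selected, and deleting it keeps the basis. *)
Lemma rank_row'_eq (F : fieldType) (m q : nat) (M : 'M[F]_(m.+1, q)) :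
  (\rank M <= m)%N -> exists i, \rank (row' i M) = \rank M.
Proof.
move=> rM; have /subsetPn[i _ iNf] : ~~ ('I_m.+1 \subset codom (maxrankfun M)).
  apply: contraL rM => sub; rewrite -ltnNge -[X in (X <= _)%N]card_ord.
  apply: leq_trans (subset_leq_card sub) _.
  by rewrite -[X in (_ <= X)%N]card_ord; exact: leq_image_card.
exists i; apply/eqP; rewrite eqn_leq; apply/andP; split.
  by rewrite row'Esub mxrankS // rowsub_sub.
rewrite -(eq_maxrowsub M) mxrankS //; apply/row_subP => k.
have /(unlift_some) [l lE _] : i != maxrankfun M k.
  by apply: contraNneq iNf => ->; exact: codom_f.
rewrite row_rowsub lE.
have -> : row (lift i l) M = row l (row' i M) by apply/rowP => c; rewrite !mxE.
exact: row_sub.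
Qed.

(** Full rank is excluded by [M *m \adj M = (\det M)%:M]. In rank exactly [n], a row and then a
    column can be deleted without loss of rank; the invertible block left over gives a nonzero
    cofactor. *)
Lemma adj_eq0_rank (F : fieldType) (n : nat) (M : 'M[F]_n.+1) :
  \adj M = 0 -> (\rank M < n)%N.
Proof.
move=> adj0; rewrite ltnNge; apply/negP => le_n.
have lt_n : (\rank M <= n)%N.
  rewrite -ltnS ltn_neqAle rank_leq_row andbT; apply/negP => /eqP rM.
  have : M \in unitmx by rewrite -row_full_unit /row_full rM.
  rewrite unitmxE unitfE => /eqP[].
  by have /matrixP/(_ 0 0) := mul_mx_adj M; rewrite adj0 mulmx0 !mxE.
have rM : \rank M = n by apply/eqP; rewrite eqn_leq lt_n.
have [i ri] := rank_row'_eq lt_n.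
have [] := @rank_row'_eq _ _ _ (row' i M)^T; first by rewrite mxrank_tr ri.
move=> j; rewrite mxrank_tr ri rM -tr_col' mxrank_tr => rj.
have : col' j (row' i M) \in unitmx by rewrite -row_full_unit /row_full rj.
have /matrixP/(_ j i) := adj0; rewrite !mxE /cofactor => /eqP.
rewrite mulf_eq0 signr_eq0 /= unitmxE unitfE => /eqP d0.
suff -> : col' j (row' i M) = row' i (col' j M) by rewrite d0 eqxx.
by apply/matrixP => ? ?; rewrite !mxE.
Qed.

(** * Points of least Euclidean norm in closed sets *)

Lemma attained_min_sum_sqr (R : realType) (N : nat) (S : set 'rV[R]_N) :
  S !=set0 -> closed S ->
  exists2 x, S x & forall y, S y -> \sum_t x 0 t ^+ 2 <= \sum_t y 0 t ^+ 2.
Proof.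
move=> [y0 Sy0] cS; pose q (x : 'rV[R]_N) := \sum_t x 0 t ^+ 2.
have cq : continuous q.
  apply: continuous_sumr => t _ x.
  exact: (continuousM (@coord_continuous _ _ _ 0 t x) (@coord_continuous _ _ _ 0 t x)).
(* Cutting [S] down to a sublevel set makes it compact; the points removed have values above [q y0],
   hence above the minimum. *)
pose B := S `&` [set x | q x <= q y0].
have cB : compact B.
  apply: bounded_closed_compact; last first.
    apply: closedI => //; apply: (@preimage_closed _ _ q [set r | r <= q y0]).
      by move=> x _; exact: cq.
    exact: closed_le.
  exists (Num.sqrt (q y0)); split; first exact: num_real.
  move=> M ltM x [_ /= qx]; apply: le_trans (ltW ltM).
  (* The norm on row vectors is the sup norm, and each coordinate is bounded by the square root of
     [q x]. *)
  rewrite /Num.Def.normr /= mx_normrE; apply: bigmax_le => [|[i t] _ /=].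
    exact: sqrtr_ge0.
  rewrite (ord1 i) -sqrtr_sqr; apply: ler_wsqrtr; apply: le_trans qx.
  by rewrite /q (bigD1 t) //= lerDl sumr_ge0 // => ? _; exact: sqr_ge0.
have [|x xB xmin] := @EVT_min_rV R N q B _ cB (continuous_subspaceT cq).
  by exists y0; split => /=.
have [Sx qx] : B x by rewrite inE in xB.
exists x => // y Sy; have [yy0|/ltW y0y] := leP (q y) (q y0).
  by apply: xmin; rewrite inE.
exact: le_trans qx y0y.
Qed.

(** * Coefficient coordinates on matrix polynomials of degree at most [d] *)

Section Coefficients.
Variables (R : realType) (n d : nat).

Notation coef_index := ('I_n * 'I_n * 'I_d.+1)%type.

Definition mx_of_coefs (x : 'rV[R]_#|{: coef_index}|) : 'M[{poly R}]_n :=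
  \matrix_(i, j) \poly_(k < d.+1) x 0 (enum_rank (i, j, inord k)).

(** Coefficients beyond degree [d] are lost, so [W] is recovered from these coordinates only when
    its degree is at most [d]. *)
Definition coefs_of_mx (W : 'M[{poly R}]_n) : 'rV[R]_#|{: coef_index}| :=
  \row_t let ijk : coef_index := enum_val t in (W ijk.1.1 ijk.1.2)`_ijk.2.

Lemma coef_mx_of_coefs x i j (k : 'I_d.+1) :
  (mx_of_coefs x i j)`_k = x 0 (enum_rank (i, j, k)).
Proof. by rewrite mxE coef_poly ltn_ord inord_val. Qed.

Lemma coef_continuous_mx_of_coefs i j :
  coef_continuous (fun x => mx_of_coefs x i j).
Proof.
move=> k; case ltk: (k < d.+1)%N; under eq_fun do [rewrite mxE coef_poly ltk].
  exact: coord_continuous.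
exact: cst_continuous.
Qed.

Lemma frobenius_mx_of_coefs x :
  frobenius (mx_of_coefs x) = Num.sqrt (\sum_t x 0 t ^+ 2).
Proof.
congr Num.sqrt; rewrite (reindex (@enum_rank _)) /=; last first.
  by apply: onW_bij; exact: enum_rank_bij.
rewrite pair_bigA.
transitivity (\sum_(ij : 'I_n * 'I_n) \sum_(k < d.+1) x 0 (enum_rank (ij, k)) ^+ 2);
  last by rewrite pair_bigA; apply: eq_bigr => -[].
apply: eq_bigr => -[i j] _ /=.
(* The sum in [frobenius] stops at the actual size of each entry; it is extended to [d.+1] terms by
   zeros. *)
have le_size : (size (mx_of_coefs x i j) <= d.+1)%N.
  by rewrite mxE; exact: size_poly.
rewrite (big_ord_widen d.+1 (fun k => (mx_of_coefs x i j)`_k ^+ 2) le_size).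
rewrite big_mkcond; apply: eq_bigr => k _; rewrite -coef_mx_of_coefs.
by case: ltnP => // lek; rewrite nth_default // expr0n.
Qed.

(** In coordinates the perturbation structure becomes the row space of a matrix, so that membership
    is a linear condition. *)
Lemma real_span_monomials (m : nat) (l : 'I_m -> nat) (C : 'I_m -> 'M[R]_n)
    (W : 'M[{poly R}]_n) :
  let M i := monomial_mx (l i) (C i) in
  let G := \matrix_i coefs_of_mx (M i) in
  (forall i, (l i <= d)%N) ->
  real_span M W <-> exists2 x, (x <= G)%MS & W = mx_of_coefs x.
Proof.
move=> M G led; have key (c : 'rV[R]_m) :
    mx_of_coefs (c *m G) = \sum_i (c 0 i)%:P *: M i.
  apply/matrixP => i j; apply/polyP => k; rewrite summxE coef_sum.
  have [ltk|gek] := ltnP k d.+1.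
    rewrite (coef_mx_of_coefs _ i j (Ordinal ltk)) mxE; apply: eq_bigr => t _.
    by rewrite [in RHS]mxE coefCM 2!mxE enum_rankK.
  (* Beyond degree [d] the left side is truncated to zero, and on the right each monomial has degree
     [l t <= d]. *)
  rewrite mxE coef_poly ltnNge gek /= big1 // => t _.
  rewrite !mxE coefCM coefXnM; case: ltnP => lek; first by rewrite mulr0.
  by rewrite coefC subn_eq0 leqNgt (leq_ltn_trans (led t)) ?mulr0.
split=> [[c ->]|[_ /submxP[c ->] ->]].
  exists ((\row_i c i) *m G); first exact: submxMl.
  by rewrite key; apply: eq_bigr => i _; rewrite mxE.
by exists (c 0); rewrite key.
Qed.

End Coefficients.

(** * The Sylvester matrix of the adjugate: continuity and vanishing *)

Lemma adj_entriesE (R : realType) (n : nat) (M : 'M[{poly R}]_n) i j :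
  adj_entries M (mxvec_index i j) = \adj M i j.
Proof. exact: mxvecE. Qed.

Lemma continuous_sylvester (T : topologicalType) (R : realType) (k : nat)
    (d' : 'I_k -> nat) (p : 'I_k) (f : T -> 'I_k -> {poly R}) i j :
  (forall q, coef_continuous (fun x => f x q)) ->
  continuous (fun x => sylvester d' p (f x) i j).
Proof.
move=> cf.
have cconv r c q a b : continuous (fun x => (conv_mx r c (f x q))^T a b).
  case leab: (a <= b)%N; under eq_fun do [rewrite !mxE leab]; first exact: cf.
  exact: cst_continuous.
rewrite /sylvester; under eq_fun do [rewrite mxE].
case: (split i) => a; first exact: cconv.
pose g x := (\mxcol_(i < k.-1) (conv_mx (second_degree d' p + d' p) (d' p)
  (f x (lift p i)))^T) a j.
suff : continuous g by [].
(* Row [a] of the stacked blocks is row [tagnat.sig2 a] of block number [tagnat.sig1 a]. *)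
have -> : g = fun x => (conv_mx (second_degree d' p + d' p) (d' p)
    (f x (lift p (tagnat.sig1 a))))^T (tagnat.sig2 a) j.
  by apply/funext => x; rewrite /g mxE.
exact: cconv.
Qed.

(** Column 0 exists and is long enough to list every coefficient of [a]. *)
Lemma conv_mx_eq0 (R : realType) (r c : nat) (a : {poly R}) :
  (0 < c)%N -> (size a <= r)%N -> conv_mx r c a = 0 -> a = 0.
Proof.
case: c => // c _ le_r /matrixP conv0; apply/polyP => k; rewrite coef0.
have [ltk|gek] := ltnP k r; last by rewrite nth_default // (leq_trans le_r).
by have := conv0 (Ordinal ltk) ord0; rewrite !mxE /= subn0.
Qed.

Lemma sylvester0 (R : realType) (k : nat) (d' : 'I_k -> nat) (p : 'I_k)
    (f : 'I_k -> {poly R}) :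
  (forall q, f q = 0) -> sylvester d' p f = 0.
Proof.
move=> f0; apply/matrixP => i j; rewrite !mxE.
by case: (split i) => a; rewrite !mxE f0 coef0 if_same.
Qed.

(** Every polynomial has its own block. As both degrees [ell] and [delta] are positive, no block is
    empty, and [ell + delta] columns hold all coefficients: a size is at most [delta + 1] at [p] and
    [ell + 1] elsewhere. *)
Lemma sylvester_eq0 (R : realType) (k : nat) (d' : 'I_k -> nat) (p : 'I_k)
    (f : 'I_k -> {poly R}) :
  (0 < second_degree d' p)%N -> (forall q, (d' q <= d' p)%N) ->
  (forall q, ((size (f q)).-1 <= d' q)%N) ->
  sylvester d' p f = 0 -> forall q, f q = 0.
Proof.
move=> ell_gt0 hp hf.
have delta_gt0 : (0 < d' p)%N by apply: leq_trans ell_gt0 _; apply/bigmax_leqP.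
rewrite /sylvester -[0]vsubmxK => /eq_col_mx[fp fi] q.
have [i ->|->] := unliftP p q; last first.
  apply: (@conv_mx_eq0 _ (second_degree d' p + d' p) _ _ ell_gt0); last first.
    by apply: trmx_inj; rewrite fp !linear0.
  by rewrite (leq_trans (leqSpred _)) // -add1n leq_add.
apply: (@conv_mx_eq0 _ (second_degree d' p + d' p) _ _ delta_gt0).
  rewrite (leq_trans (leqSpred _)) // -addn1 leq_add //.
  apply: leq_trans (hf _) _; apply: leq_bigmax_cond.
  by rewrite eq_sym neq_lift.
apply: trmx_inj; rewrite !linear0 in fi *.
rewrite -(mxcolK (fun i => (conv_mx (second_degree d' p + d' p) (d' p)
  (f (lift p i)))^T) i) fi.
by apply/matrixP => a b; rewrite !mxE.
Qed.

(** Evaluation at the single point 0 suffices, the McCoy rank being a minimum. It is a ring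
    morphism, so it commutes with the adjugate. *)
Lemma adj_eq0_nontrivial_smith (R : realType) (n : nat) (M : 'M[{poly R}]_n.+1) :
  \adj M = 0 -> nontrivial_smith M.
Proof.
move=> adj0; rewrite /nontrivial_smith /mccoy_rank.
case: ex_minnP => r _ /(_ (\rank (eval_mx 0 M))) rmin.
have /rmin le_r : `[< exists w, \rank (eval_mx w M) = \rank (eval_mx 0 M) >].
  by apply/asboolP; exists 0.
rewrite addn2 !ltnS; apply: leq_ltn_trans le_r _; apply: adj_eq0_rank.
rewrite /eval_mx.
rewrite -(map_mx_adj (horner_eval (0 : R[i]) \o map_poly (real_complex R))).
by rewrite adj0 map_mx0.
Qed.

(** Size at least 2 matters: the adjugate of the zero matrix of size 1 is 1. *)
Lemma adj_mx0 (R : comPzRingType) (n : nat) : \adj (0 : 'M[R]_n.+2) = 0.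
Proof.
apply/matrixP => i j; rewrite !mxE /cofactor (_ : row' _ _ = 0) ?det0 ?mulr0 //.
by apply/matrixP => k l; rewrite !mxE.
Qed.

Lemma rank_sylvester_gt0 (R : realType) (n : nat) (A : 'M[{poly R}]_n.+1)
    (d' : 'I_(n.+1 * n.+1) -> nat) (p : 'I_(n.+1 * n.+1)) :
  ~ nontrivial_smith A -> (0 < second_degree d' p)%N ->
  (forall q, (d' q <= d' p)%N) ->
  (forall q, ((size (adj_entries A q)).-1 <= d' q)%N) ->
  (0 < \rank (sylvester d' p (adj_entries A)))%N.
Proof.
move=> htrivial ell_gt0 hp hd'; rewrite lt0n mxrank_eq0; apply/eqP => syl0.
apply: htrivial; apply: adj_eq0_nontrivial_smith; apply/matrixP => i j.
by rewrite -adj_entriesE (sylvester_eq0 ell_gt0 hp hd' syl0) mxE.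
Qed.

Lemma coef_continuous_adj_entries (T : topologicalType) (R : realType) (n : nat)
    (F : T -> 'M[{poly R}]_n) q :
  (forall i j, coef_continuous (fun x => F x i j)) ->
  coef_continuous (fun x => adj_entries (F x) q).
Proof.
move=> cF; case/mxvec_indexP: q => i j; under eq_fun do [rewrite adj_entriesE].
exact: coef_continuous_adj.
Qed.

(** In size 1 the adjugate is the constant 1, so both degrees are 0 and the Sylvester matrix has no
    columns. *)
Lemma sylvester_mx1_rank (R : realType) (V : set 'M[{poly R}]_1) A
    (d' : 'I_(1 * 1) -> nat) p (f : 'I_(1 * 1) -> {poly R}) :
  max_adj_degrees V A d' ->
  second_degree d' p = 0%N /\ \rank (sylvester d' p f) = 0%N.
Proof.
move=> /(_ p)[[D _ d'p] _].
have ell0 : second_degree d' p = 0%N.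
  by rewrite /second_degree big_pred0 // => q; rewrite (ord1 p) (ord1 q) eqxx.
split=> //; apply/eqP; rewrite -leqn0; apply: leq_trans (rank_leq_col _) _.
rewrite ell0 -d'p; case/mxvec_indexP: p {d'p ell0} => i j.
rewrite adj_entriesE !mxE /cofactor det_mx00 mulr1.
by rewrite (ord1 i) (ord1 j) size_poly1.
Qed.

(** * Linear constraints, infima and the minimizer *)

Lemma closed_submx (K : numFieldType) (m N : nat) (G : 'M[K]_(m, N)) :
  closed [set x : 'rV[K]_N | (x <= G)%MS].
Proof.
(* The row space of [G] is the left kernel of [cokermx G], hence given by linear equations. *)
rewrite (_ : mkset _ = \bigcap_(t in [set: 'I_N]) [set x | (x *m cokermx G) 0 t = 0]).
  apply: closed_bigI => t _; apply: closed_zero_locus.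
  apply: continuous_mulmx => a b; first exact: coord_continuous.
  exact: cst_continuous.
apply/seteqP; split=> x /=; first by rewrite submxE => /eqP xG t _; rewrite /= xG mxE.
by move=> x0; rewrite submxE; apply/eqP/rowP => t; rewrite (x0 t I) mxE.
Qed.

Lemma minimum_attained_inf (T : Type) (R : realType) (f : T -> R) (S : set T) x :
  S x -> (forall y, S y -> f x <= f y) -> infimum_attained f S.
Proof.
move=> Sx xmin; exists x => //; apply/le_anti/andP; split.
  by apply: lb_le_inf; [exists (f x), x|move=> _ [y Sy <-]; exact: xmin].
by apply: ge_inf; [exists (f x) => _ [y Sy <-]; exact: xmin|exists x].
Qed.

Theorem theorem3p8 (R : realType) (n d : nat) (V : set 'M[{poly R}]_n)
    (A : 'M[{poly R}]_n) (d' : 'I_(n * n) -> nat) (p : 'I_(n * n))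
    (hV : linear_perturbation_structure d V)
    (hA : V A)
    (htrivial : ~ nontrivial_smith A)
    (hattainable : ~ unattainable_nontrivial_smith V A)
    (hd' : max_adj_degrees V A d')
    (hp : forall q : 'I_(n * n), (d' q <= d' p)%N)
    (hdegenerate : second_degree d' p = 0%N ->
       (0 < \rank (sylvester d' p (adj_entries A)))%N) :
  let e := \rank (sylvester d' p (adj_entries A)) in
  infimum_attained (@frobenius R n)
    [set D | V D /\ (\rank (sylvester d' p (adj_entries (A + D))) < e)%N].
Proof.
(* For [n = 0] there is no index [p]; for [n = 1] the rank is 0, against [hdegenerate]. *)
case: n => [|[|n]] in V A d' p hV hA htrivial hattainable hd' hp hdegenerate *.
- by have := ltn_ord p.
- have [ell0 rk0] := sylvester_mx1_rank p (adj_entries A) hd'.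
  by move: (hdegenerate ell0); rewrite rk0.
move=> e; case: hV => m [l [C [led defV]]].
have V0 : V 0.
  by rewrite defV; exists (fun=> 0); rewrite big1 // => i _; rewrite polyC0 scale0r.
have VN : V (- A).
  move: hA; rewrite defV => -[c ->]; exists (fun i => - c i).
  by rewrite -sumrN; apply: eq_bigr => i _; rewrite polyCN scaleNr.
(* The degree bounds apply to [A] itself through the zero perturbation. *)
have hdA q : ((size (adj_entries A q)).-1 <= d' q)%N.
  by have := (hd' q).2 0 V0; rewrite addr0.
pose S := [set x | (x <= \matrix_i coefs_of_mx d (monomial_mx (l i) (C i)))%MS /\
  (\rank (sylvester d' p (adj_entries (A + mx_of_coefs x))) < e)%N].
have VE D : V D <->
    exists2 x, (x <= \matrix_i coefs_of_mx d (monomial_mx (l i) (C i)))%MS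
             & D = mx_of_coefs x by rewrite defV; exact: real_span_monomials.
have [x Sx xmin] : exists2 x, S x &
    forall y, S y -> \sum_t x 0 t ^+ 2 <= \sum_t y 0 t ^+ 2.
  apply: attained_min_sum_sqr.
    (* The witness is the coordinate vector of [- A], which turns the constraint into [0 < e]; this
       is [hdegenerate] when the second degree is 0, and follows from the trivial Smith form
       otherwise. *)
    have /VE[x xG xE] := VN; exists x; split => //; rewrite -xE subrr.
    rewrite sylvester0 ?mxrank0.
      have [/hdegenerate //|ell_gt0] := posnP (second_degree d' p).
      exact: rank_sylvester_gt0.
    by case/mxvec_indexP => i j; rewrite adj_entriesE adj_mx0 mxE.
  apply: closedI; first exact: closed_submx.
  apply: rank_lt_closed => i j; apply: continuous_sylvester => q.
  apply: coef_continuous_adj_entries => a b; under eq_fun do [rewrite mxE].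
  apply: coef_continuousD; first exact: coef_continuous_cst.
  exact: coef_continuous_mx_of_coefs.
apply: (@minimum_attained_inf _ _ _ _ (mx_of_coefs x)).
  by case: Sx => xG rx; split => //; apply/VE; exists x.
move=> _ [/VE[y yG ->] ry]; rewrite !frobenius_mx_of_coefs.
by apply: ler_wsqrtr; apply: xmin.
Qed.
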